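(* For an integer $n \ge 1$, let $G_n$ be the cubic graph obtained from a circuit of length $2n$ by replacing every second edge by two parallel edges. If $n=1$, then $\overline{{\cal S}}(G_n) = \{3\}$. If $n=2$, then $\overline{{\cal S}}(G_n) = \{3,4\}$. If $n \ge 3$, then $\overline{{\cal S}}(G_n) = \{3,4,6\}$.
   Context: Graphs are finite and may have parallel edges but no loops. (A circuit of length $2$ consists of two vertices joined by two parallel edges, so $G_1$ is the graph on two vertices joined by three parallel edges.) A signed graph $(G,\sigma)$ is a graph $G$ with a function (signature) $\sigma: E(G)\to\{\pm1\}$. Each edge $e=uv$ is divided into two half-edges $h_e^u$ (incident with $u$) and $h_e^v$ (incident with $v$); $H(G)$ is the set of half-edges, $H(v)$ the set of half-edges incident with $v$, and $e_h$ the edge containing the half-edge $h$. An orientation of $(G,\sigma)$ is a function $\tau: H(G)\to\{\pm1\}$ with $\tau(h_e^u)\tau(h_e^v) = -\sigma(e)$ for each edge $e=uv$. Given an orientation $\tau$, the boundary of $f:E(G)\to\mathbb{R}$ is $\delta f(v)=\sum_{h\in H(v)}\tau(h)f(e_h)$. For real $r\ge 2$, $f$ is an $r$-flow on $(G,\sigma)$ if, for every edge $e$, $f(e)=0$ or $1\le |f(e)|\le r-1$, and $\delta f(v)=0$ for all $v\in V(G)$; it is nowhere-zero if $f(e)\ne 0$ for all $e$. $(G,\sigma)$ admits a nowhere-zero $r$-flow if one exists for some orientation, and $(G,\sigma)$ is flow-admissible if it admits a nowhere-zero $r$-flow for some $r\ge2$. $F((G,\sigma))$ is the smallest integer $k$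 such that $(G,\sigma)$ admits an integer-valued nowhere-zero $k$-flow. The integer flow spectrum $\overline{{\cal S}}(G)$ is the set of all $F((G,\sigma))$, where $\sigma$ ranges over all signatures of $G$ for which $(G,\sigma)$ is flow-admissible. *)

(* Defs.v *)
From HB Require Import structures.
From mathcomp Require Import all_boot all_order all_algebra.
From mathcomp Require Import boolp classical_sets reals.

Set Implicit Arguments.
Unset Strict Implicit.
Unset Printing Implicit Defensive.

Import Order.TTheory GRing.Theory Num.Theory.

Local Open Scope ring_scope.
Local Open Scope classical_set_scope.

(* Each edge e has the two (distinct) ends [ends e false] and [ends e true];
   distinct edges may have the same ends. *)
Record mgraph := MGraph {
  vertex : finType;
  edge : finType;
  ends : edge -> bool -> vertex;
  loopless : forall e, ends e false != ends e true
}.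

(* The half-edge (e, b) is the half of e incident with [ends e b]. *)
Definition half_edge (G : mgraph) : finType := (edge G * bool)%type.

Definition half_end (G : mgraph) (h : half_edge G) : vertex G := ends h.1 h.2.

(* The set {1, -1} is encoded by bool, with [true] standing for -1. *)
Definition signature (G : mgraph) := edge G -> bool.

Definition sgn (S : pzRingType) (b : bool) : S := (-1) ^+ b.

Definition is_orientation (G : mgraph) (sigma : signature G)
    (tau : half_edge G -> bool) : Prop :=
  forall e : edge G,
    sgn int (tau (e, false)) * sgn int (tau (e, true)) = - sgn int (sigma e).

Section Flows.
Variables (R : realType) (G : mgraph).
Implicit Types (sigma : signature G) (tau : half_edge G -> bool).
Implicit Types (f : edge G -> R) (r : R) (k : nat).

Definition boundary tau f (v : vertex G) : R :=
  \sum_(h : half_edge G | half_end h == v) sgn R (tau h) * f h.1.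

Definition is_flow r tau f : Prop :=
  (forall e, f e = 0 \/ 1 <= `|f e| <= r - 1) /\
  (forall v, boundary tau f v = 0).

Definition nowhere_zero f : Prop := forall e, f e != 0.

Definition integer_valued f : Prop := forall e, f e \is a Num.int.

Definition admits_nz_flow sigma r : Prop :=
  exists tau f, [/\ is_orientation sigma tau, is_flow r tau f & nowhere_zero f].

Definition flow_admissible sigma : Prop :=
  exists r, 2 <= r /\ admits_nz_flow sigma r.

Definition admits_integer_nz_flow sigma k : Prop :=
  exists tau f, [/\ is_orientation sigma tau, is_flow k%:R tau f,
    nowhere_zero f & integer_valued f].

Definition is_flow_number sigma k : Prop :=
  [/\ (2 <= k)%N, admits_integer_nz_flow sigma k &
      forall k', (2 <= k')%N -> admits_integer_nz_flow sigma k' -> (k <= k')%N].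

(* The default value 0, taken when there is no integer-valued nowhere-zero
   flow at all, is never a flow number. *)
Definition flow_number sigma : nat := xget 0%N [set k | is_flow_number sigma k].

Definition integer_flow_spectrum : set nat :=
  [set flow_number sigma | sigma in [set sigma | flow_admissible sigma]].

End Flows.

(* The circuit of length 2n has vertices and edges indexed by 'I_(2n), its edge
   i joining i to i + 1 (mod 2n).  The edge [inr j] is a second copy of the
   circuit edge 2j, so that exactly every second edge is doubled. *)
Definition dbl_ord (n : nat) (j : 'I_n) : 'I_n.*2 :=
  @Ordinal n.*2 j.*2 (etrans (ltn_double j n) (ltn_ord j)).

Definition necklace_base (n : nat) (e : 'I_n.*2 + 'I_n) : 'I_n.*2 :=
  match e with inl i => i | inr j => dbl_ord j end.

Definition necklace_ends (n : nat) (e : 'I_n.*2 + 'I_n) (b : bool) : 'I_n.*2 :=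
  if b then ordS (necklace_base e) else necklace_base e.

Lemma necklace_loopless (n : nat) (e : 'I_n.*2 + 'I_n) :
  necklace_ends e false != necklace_ends e true.
Proof.
rewrite /necklace_ends -val_eqE /=; case: (necklace_base e) => i lti /=.
have [lt|] := ltnP i.+1 n.*2; first by rewrite modn_small // neq_ltn ltnSn.
move=> le; have ei : i.+1 = n.*2 by apply/eqP; rewrite eqn_leq lti le.
rewrite ei modnn; apply/eqP => i0; move: ei; rewrite i0.
by case: n {e lti le}.
Qed.

Definition necklace (n : nat) : mgraph := MGraph (@necklace_loopless n).

(* Main.v *)
Require Import Defs.
From mathcomp Require Import all_boot all_order all_algebra.
From mathcomp Require Import boolp classical_sets reals.
From mathcomp Require Import zify lra.

Set Implicit Arguments.
Unset Strict Implicit.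
Unset Printing Implicit Defensive.

Import Order.TTheory GRing.Theory Num.Theory.

Local Open Scope ring_scope.

(** Orient every half-edge at the first end of its edge outwards.  A flow is
    then a function [x] on the edges, and it is governed by the values [u], [w]
    on the two single edges (the links) next to each digon.  With [a], [b] the
    values on the two edges of the digon, [a + b = u] up to sign, and
    [w = a + b] or [w = a - b], up to sign, according to whether the two signs
    of the digon agree or differ.  Since [a] and [b] are nonzero,
    [`|w| = `|u|] at a balanced digon and [`|w| <> `|u|] at an unbalanced one;
    for integers, [w] and [u] always have the same parity.

    Hence, going around the necklace, the absolute value on the links changes
    exactly at the unbalanced digons.  Let [t] be their number.
    - [t = 1] is impossible, even over the reals ([unbalanced_neq1]).
    - No 2-flow exists, since a sum of three values 1 or -1 is odd.
    - If [t > 0], some link value changes to another one of the same parity, so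
      some absolute value is at least 3: no 3-flow exists.
    - If [t] is odd, the link values cannot alternate between two sizes; a
      5-flow allows only the sizes 1, 3 or only the sizes 2, 4, so none exists.
    These are the lower bounds of [integer_nz_flow_ge].

    Conversely, take a real nowhere-zero flow.  The signs of its link values are
    consistent along balanced digons ([link_sign_consistent]), and at an
    unbalanced digon the sign of [w] is free, as exchanging the edges of the
    digon reverses it.  So these signs can be combined with any odd sizes that
    change exactly at the unbalanced digons: the constant 1 if [t = 0],
    alternating 1 and 3 if [t] is even, and alternating 1 and 3 with a single
    arc of size 5 if [t] is odd ([cyclic_link_size]).  Every digon can then be
    filled ([digon_split]), and the flow number is 3, 4 or 6
    ([flow_numberE]).  As [t] can be any number in [0 .. n] other than 1,
    the spectrum follows. *)

(** * Conservation around the necklace *)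

Lemma sgn_mulE (S : pzRingType) b (x : S) : sgn S b * x = if b then - x else x.
Proof. by case: b; rewrite /sgn ?expr1 ?mulN1r ?expr0 ?mul1r. Qed.

Lemma norm_sgn_mul (S : numDomainType) b (x : S) : `|sgn S b * x| = `|x|.
Proof. by rewrite sgn_mulE; case: b; rewrite ?normrN. Qed.

(** The single edge that leaves the digon [j], and also its first end. *)
Definition link n (j : 'I_n) : 'I_n.*2 := ordS (dbl_ord j).

Lemma val_link n (j : 'I_n) : link j = j.*2.+1 :> nat.
Proof. by rewrite /= modn_small //; move: (ltn_ord j); lia. Qed.

Lemma ordS_link n (j : 'I_n) : ordS (link j) = dbl_ord (ordS j).
Proof.
apply: val_inj; have -> : val (ordS (link j)) = ((link j).+1 %% n.*2)%N by [].
by rewrite val_link /= -doubleS -!muln2 -muln_modl.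
Qed.

Lemma dbl_ord_inj n : injective (@dbl_ord n).
Proof. by move=> i j [] /double_inj /val_inj. Qed.

Lemma link_neq_dbl n (i j : 'I_n) : (link i == dbl_ord j) = false.
Proof.
by apply/negP => /eqP /(congr1 (@nat_of_ord _)); rewrite val_link /=; lia.
Qed.

Variant dbl_link_spec n : 'I_n.*2 -> Type :=
  | IsDbl j : dbl_link_spec (dbl_ord j)
  | IsLink j : dbl_link_spec (link j).

Lemma bead_subproof n (i : 'I_n.*2) : (i./2 < n)%N.
Proof. by move: (ltn_ord i); lia. Qed.

(** The digon that contains the circuit edge [i], or that the link [i]
    leaves. *)
Definition bead n (i : 'I_n.*2) : 'I_n := Ordinal (bead_subproof i).

Lemma bead_dbl n : cancel (@dbl_ord n) (@bead n).
Proof. by move=> j; apply: ord_inj; rewrite /= doubleK. Qed.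

Lemma bead_link n : cancel (@link n) (@bead n).
Proof.
move=> j; apply: ord_inj.
have -> : bead (link j) = (link j)./2 :> nat by [].
by rewrite val_link; lia.
Qed.

Lemma dbl_linkP n (i : 'I_n.*2) : dbl_link_spec i.
Proof.
case: (boolP (odd i)) => oi.
  suff -> : i = link (bead i) by right.
  by apply: ord_inj; rewrite val_link /=; lia.
suff -> : i = dbl_ord (bead i) by left.
by apply: ord_inj => /=; lia.
Qed.

(** Kirchhoff's law in the orientation [outward] below: the first equation
    is the law at the vertex where the link [j] enters the next digon, the
    second one at the vertex where it leaves the digon [j]. *)
Definition conserved (S : pzRingType) n (sigma : signature (necklace n))
    (x : edge (necklace n) -> S) : Prop :=
  forall j : 'I_n,
    x (inl (dbl_ord (ordS j))) + x (inr (ordS j)) =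
      sgn S (sigma (inl (link j))) * x (inl (link j)) /\
    x (inl (link j)) = sgn S (sigma (inl (dbl_ord j))) * x (inl (dbl_ord j))
      + sgn S (sigma (inr j)) * x (inr j).

Lemma boundary_split (R : realType) n tau (f : edge (necklace n) -> R) v :
  let phi h := sgn R (tau h) * f h.1 in
  boundary tau f v =
    phi (inl v, false) + \sum_(j < n | dbl_ord j == v) phi (inr j, false)
    + (phi (inl (ord_pred v), true)
       + \sum_(j < n | link j == v) phi (inr j, true)).
Proof.
move=> phi; rewrite /boundary big_mkcond /=.
transitivity (\sum_(e : edge (necklace n)) \sum_(b : bool)
    if half_end (G := necklace n) (e, b) == v then phi (e, b) else 0).
  by rewrite pair_bigA; apply: eq_bigr => -[].
rewrite (eq_bigr _ (fun e _ => big_bool _ _)).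
rewrite big_split [LHS]addrC /=; congr (_ + _).
  rewrite big_sumType /= -!big_mkcond /=.
  by rewrite (big_pred1 v).
rewrite big_sumType /= -!big_mkcond /= (big_pred1 (ord_pred v)) // => i.
by rewrite /half_end /= /necklace_ends /= (can2_eq (@ordSK _) (@ord_predK _)).
Qed.

Lemma boundary_dbl (R : realType) n tau (f : edge (necklace n) -> R) (j : 'I_n) :
  let phi h := sgn R (tau h) * f h.1 in
  boundary tau f (dbl_ord (ordS j)) =
    phi (inl (dbl_ord (ordS j)), false) + phi (inr (ordS j), false)
    + phi (inl (link j), true).
Proof.
move=> phi; rewrite boundary_split /= -/phi.
rewrite (big_pred1 (ordS j)) => [|i]; last exact: (inj_eq (@dbl_ord_inj n)).
rewrite [X in _ + (_ + X)]big_pred0 => [|i]; last exact: link_neq_dbl.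
by rewrite addr0 -ordS_link ordSK.
Qed.

Lemma boundary_link (R : realType) n tau (f : edge (necklace n) -> R) (j : 'I_n) :
  let phi h := sgn R (tau h) * f h.1 in
  boundary tau f (link j) =
    phi (inl (link j), false)
    + (phi (inl (dbl_ord j), true) + phi (inr j, true)).
Proof.
move=> phi; rewrite boundary_split /= -/phi.
rewrite big_pred0 => [|i]; last by rewrite eq_sym link_neq_dbl.
rewrite (big_pred1 j) => [|i]; first by rewrite addr0 ordSK.
by rewrite (inj_eq (@ordS_inj _)) (inj_eq (@dbl_ord_inj n)).
Qed.

(** Whatever the orientation, multiplying the value of each edge by the sign
    of its first half-edge turns the conditions into those of [conserved]. *)
Lemma boundary0P (R : realType) n (sigma : signature (necklace n)) tau
    (f : edge (necklace n) -> R) :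
  is_orientation sigma tau ->
  (forall v, boundary tau f v = 0) <->
  conserved sigma (fun e => sgn R (tau (e, false)) * f e).
Proof.
move=> ori.
have phiT e : sgn R (tau (e, true)) * f e
    = - (sgn R (sigma e) * (sgn R (tau (e, false)) * f e)).
  have := ori e; rewrite !sgn_mulE.
  by case: (tau (e, true)); case: (tau (e, false)); case: (sigma e) => //=;
     rewrite ?opprK.
split=> [b0 j | cons v].
  split.
    apply/subr0_eq; rewrite -[RHS](b0 (dbl_ord (ordS j))).
    by rewrite boundary_dbl /= phiT.
  by apply/subr0_eq; rewrite -[RHS](b0 (link j)) boundary_link /= !phiT opprD.
case: (dbl_linkP v) => j.
  rewrite -[j]ord_predK boundary_dbl /= phiT.
  by have [-> _] := cons (ord_pred j); rewrite subrr.
by rewrite boundary_link /= !phiT; have [_ ->] := cons j; rewrite -opprD subrr.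
Qed.

Definition outward n (sigma : signature (necklace n))
  (h : half_edge (necklace n)) : bool := if h.2 then ~~ sigma h.1 else false.

Lemma outward_orientation n (sigma : signature (necklace n)) :
  is_orientation sigma (outward sigma).
Proof. by move=> e; rewrite sgn_mulE /outward /=; case: (sigma e). Qed.

Lemma nz_flow_conserved (R : realType) n (sigma : signature (necklace n)) r tau
    (f : edge (necklace n) -> R) :
  is_orientation sigma tau -> is_flow r tau f -> nowhere_zero f ->
  conserved sigma (fun e => sgn R (tau (e, false)) * f e) /\
  forall e, 1 <= `|sgn R (tau (e, false)) * f e| <= r - 1.
Proof.
move=> ori [fr f0] nz; split; first exact/boundary0P.
move=> e; rewrite norm_sgn_mul.
by case: (fr e) => // fe; move: (nz e); rewrite fe eqxx.
Qed.

Lemma integer_nz_flowP (R : realType) n (sigma : signature (necklace n)) k :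
  admits_integer_nz_flow R sigma k <->
  exists2 x : edge (necklace n) -> int,
    conserved sigma x & forall e, 1 <= `|x e| <= k%:Z - 1.
Proof.
have intrS b (m : int) : (sgn int b * m)%:~R = sgn R b * m%:~R.
  by rewrite !sgn_mulE; case: b; rewrite ?rmorphN.
split=> [[tau [f [ori fl nz fint]]] | [x cons bnd]].
  have /boolp.choice[x fE] e : exists m : int, f e = m%:~R by exact/intrP.
  have [cons bnd] := nz_flow_conserved ori fl nz.
  exists (fun e => sgn int (tau (e, false)) * x e) => [j|e].
    have := cons j; rewrite /= !fE -!intrS -!rmorphD.
    by case=> /intr_inj ? /intr_inj.
  have := bnd e.
  rewrite fE -intrS -intr_norm -[k%:R]/(k%:Z%:~R) -(rmorphB _ _ 1).
  by rewrite !ler_int ler1z.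
pose f e : R := (x e)%:~R; exists (outward sigma), f.
have fbnd e : 1 <= `|f e| <= k%:R - 1.
  by rewrite -intr_norm -[k%:R]/(k%:Z%:~R) -(rmorphB _ _ 1) ler_int ler1z.
split.
- exact: outward_orientation.
- split; first by move=> e; right.
  apply/(boundary0P _ (outward_orientation sigma)) => j.
  rewrite /outward /= /f [sgn R false]expr0 !mul1r -!intrS -!rmorphD.
  by have [<- <-] := cons j.
- by move=> e; rewrite -normr_gt0; case/andP: (fbnd e) => /(lt_le_trans ltr01).
- by move=> e; apply/intrP; exists (x e).
Qed.

Lemma integer_nz_flow_real (R : realType) n (sigma : signature (necklace n)) k :
  admits_integer_nz_flow R sigma k -> admits_nz_flow sigma (k%:R : R).
Proof. by case=> tau [f [? ? ? _]]; exists tau, f. Qed.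

(** * Digons *)

Definition unbalanced n (sigma : signature (necklace n)) : {set 'I_n} :=
  [set j | sigma (inl (dbl_ord j)) != sigma (inr j)].

Section Digon.
Variables (S : realDomainType) (p q : bool) (a b : S).
Hypotheses (a0 : a != 0) (b0 : b != 0).

(** If [a + b = a - b] then [b = 0]; if [a + b = b - a] then [a = 0]. *)
Lemma digon_norm_neq :
  p != q -> `|sgn S p * a + sgn S q * b| != `|a + b|.
Proof.
rewrite eqr_norm2 !sgn_mulE => pq; apply/negP => E.
suff /orP[] : (a == 0) || (b == 0) by apply/negP.
by case/orP: E => /eqP; move: pq; case: p; case: q => //= _ E;
   apply/orP; (left; apply/eqP; lra) || (right; apply/eqP; lra).
Qed.

End Digon.

(** Absolute values up to 4 of one parity are 1, 3 or 2, 4, so that being at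
    most 2 tells them apart: this bit flips exactly at an unbalanced digon. *)
Lemma digon_int_pass (p q : bool) (a b u w : int) :
  a + b = u -> w = sgn int p * a + sgn int q * b ->
  1 <= `|a| -> 1 <= `|b| -> 1 <= `|u| <= 4 -> 1 <= `|w| <= 4 ->
  (`|w| <= 2) = (`|u| <= 2) (+) (p != q).
Proof.
rewrite !sgn_mulE; case: p; case: q => /=; rewrite ?addbT ?addbF; lia.
Qed.

(** The balanced case splits [u] without using 0; the unbalanced case solves
    [a + b = u] and [a - b = w], up to sign, and then [`|a|] and [`|b|] are at
    most [(`|u| + `|w|) / 2]. *)
Lemma digon_split (p q : bool) (u w K : int) :
  2 <= K -> 1 <= `|u| <= K -> 1 <= `|w| <= K ->
  (if p == q then w = sgn int p * u
   else `|w| <> `|u| /\ exists m, w = u + 2 * m) ->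
  exists ab : int * int,
    [/\ ab.1 + ab.2 = u, w = sgn int p * ab.1 + sgn int q * ab.2,
        1 <= `|ab.1| <= K & 1 <= `|ab.2| <= K].
Proof.
move=> K2 uK wK; case: eqVneq => [<- -> | pq [neq [m wE]]].
  have [u1|u1] := boolP (`|u| == 1).
    by exists (2 * u, - u); split => /=; rewrite ?sgn_mulE; case: p; lia.
  exists (u - Num.sg u, Num.sg u); split => /=; rewrite ?sgn_mulE; case: p; lia.
exists (if p then (- m, u + m) else (u + m, - m)).
by case: p pq; case: q => //= _; split => /=; rewrite ?sgn_mulE; lia.
Qed.

(** * Lower bounds *)

(** The flow number when [t] digons are unbalanced, for [t] other than 1. *)
Definition necklace_flow_number t : nat :=
  if t == 0%N then 3 else if odd t then 6 else 4.

Lemma big_ordS T (idx : T) (op : Monoid.com_law idx) n (F : 'I_n -> T) :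
  \big[op/idx]_j F (ordS j) = \big[op/idx]_j F j.
Proof. by rewrite [RHS](reindex_inj (@ordS_inj n)). Qed.

Lemma odd_set_sum (T : finType) (A : {set T}) :
  \big[addb/false]_(i : T) (i \in A) = odd #|A|.
Proof.
rewrite -sum1_card [in RHS]big_mkcond /=.
rewrite (big_morph odd oddD (erefl : odd 0 = false)).
by apply: eq_bigr => i _; case: (i \in A).
Qed.

Lemma integer_nz_flow_ge (R : realType) n (sigma : signature (necklace n)) k :
  (0 < n)%N -> admits_integer_nz_flow R sigma k ->
  (necklace_flow_number #|unbalanced sigma| <= k)%N.
Proof.
move=> n0 /integer_nz_flowP[x cons bnd].
pose y j := x (inl (link j)).
have k3 : (3 <= k)%N.
  have [_ ] := cons (Ordinal n0); rewrite !sgn_mulE.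
  set j := Ordinal n0.
  move: (bnd (inl (link j))) (bnd (inl (dbl_ord j))) (bnd (inr j)).
  by case: (sigma _); case: (sigma _); lia.
have pass j : (k <= 5)%N ->
    (`|y (ordS j)| <= 2) = (`|y j| <= 2) (+) (ordS j \in unbalanced sigma).
  move=> k5; have [in_j _] := cons j; have [_ out_j] := cons (ordS j).
  rewrite -(norm_sgn_mul (sigma (inl (link j))) (y j)) inE.
  have bnd4 e : 1 <= `|x e| <= 4 by have := bnd e; lia.
  apply: (digon_int_pass in_j out_j); rewrite ?norm_sgn_mul ?bnd4 //.
  - by have := bnd (inl (dbl_ord (ordS j))); lia.
  - by have := bnd (inr (ordS j)); lia.
rewrite /necklace_flow_number; case: ifP => // t0.
have k4 : (4 <= k)%N.
  rewrite ltnNge; apply/negP => k3'.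
  have /set0Pn[i iU] : unbalanced sigma != finset.set0 by rewrite -cards_eq0 t0.
  have := pass (ord_pred i); rewrite ord_predK iU addbT => /(_ ltac:(lia)).
  have := bnd (inl (link (ord_pred i))); have := bnd (inl (link i)).
  by rewrite -!/(y _); lia.
case: ifP => // todd; rewrite ltnNge; apply/negP => k5.
(* The bit [`|y j| <= 2] returns to its value after a full turn, so it flips an
   even number of times. *)
move: todd; rewrite -odd_set_sum.
have := big_ordS addb (fun j => `|y j| <= 2).
under eq_bigr do rewrite pass //.
rewrite big_split /= => /(congr1 (addb (\big[addb/false]_j (`|y j| <= 2)))).
rewrite addKb addbb.
by rewrite (big_ordS addb (fun i => i \in unbalanced sigma)) => ->.
Qed.

(** * Signs and sizes on the links *)

(** The condition on the signs of the link values ([true] for negative) that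
    the balanced digons impose. *)
Definition consistent n (sigma : signature (necklace n)) (z : 'I_n -> bool) :=
  forall j, ordS j \notin unbalanced sigma ->
  z (ordS j) = z j (+) sigma (inl (link j)) (+) sigma (inl (dbl_ord (ordS j))).

Section RealFlow.
Variables (R : realType) (n : nat) (sigma : signature (necklace n)).
Variable x : edge (necklace n) -> R.
Hypotheses (cons : conserved sigma x) (x0 : forall e, x e != 0).

Let y j := x (inl (link j)).

Lemma link_flow_balanced j : ordS j \notin unbalanced sigma ->
  y (ordS j) = sgn R (sigma (inl (dbl_ord (ordS j)))) *
                 (sgn R (sigma (inl (link j))) * y j).
Proof.
rewrite inE negbK => /eqP bal.
have [<- _] := cons j; have [_ ] := cons (ordS j).
by rewrite -bal -mulrDr.
Qed.

Lemma link_flow_norm j :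
  (`|y (ordS j)| == `|y j|) = (ordS j \notin unbalanced sigma).
Proof.
have [unb|bal] := boolP (ordS j \in _); last first.
  by rewrite link_flow_balanced // !norm_sgn_mul eqxx.
rewrite -(norm_sgn_mul (sigma (inl (link j))) (y j)).
have [<- _] := cons j; have [_ yE] := cons (ordS j).
apply/negbTE; rewrite /y yE; apply: digon_norm_neq => //.
by move: unb; rewrite inE.
Qed.

(** The size of the link values would change exactly once around the necklace;
    but its increments add up to 0. *)
Lemma unbalanced_neq1 : #|unbalanced sigma| != 1%N.
Proof.
apply/negP => /cards1P[i Ui].
have : \sum_j (`|y (ordS j)| - `|y j|) = 0.
  by rewrite sumrB (big_ordS +%R (fun j => `|y j|)) subrr.
rewrite (bigD1 (ord_pred i)) //= big1 => [|j ji].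
  move=> /eqP; rewrite addr0 subr_eq0 link_flow_norm ord_predK Ui.
  by rewrite set11.
apply/eqP; rewrite subr_eq0 link_flow_norm Ui finset.in_set1.
by rewrite (can2_eq (@ordSK _) (@ord_predK _)).
Qed.

Lemma link_sign_consistent : consistent sigma (fun j => y j < 0).
Proof.
have sN b (a : R) : a != 0 -> (sgn R b * a < 0) = (a < 0) (+) b.
  move=> a0; rewrite sgn_mulE; case: b; rewrite ?addbF // addbT.
  by rewrite oppr_lt0 lt_neqAle eq_sym a0 leNgt.
move=> j bal; rewrite link_flow_balanced // !sN //; first exact: x0.
by rewrite -normr_eq0 norm_sgn_mul normr_eq0; exact: x0.
Qed.

End RealFlow.

(** Sizes of the [t] arcs of links between unbalanced digons, numbered
    cyclically by [r < t].  Alternating 1 and 3 fails at the closing of an odd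
    cycle, so that the arc 0 gets the third size 5 there. *)
Definition link_size t r : nat :=
  if odd t && (r == 0) then 5 else if odd r then 3 else 1.

Lemma link_size_neq t c : (1 < t)%N ->
  link_size t (c.+1 %% t)%N != link_size t (c %% t)%N.
Proof.
move=> t1; rewrite modnS.
have lt : (c %% t < t)%N by rewrite ltn_mod; lia.
case: ifP => [/dvdnP[q cE]|ndvd].
  have -> : (c %% t = t.-1)%N.
    case: q cE => [//|q] cE; have -> : c = (q * t + t.-1)%N by lia.
    by rewrite modnMDl modn_small; lia.
  by rewrite /link_size; case: t t1 {lt cE} => [|[|t]] //= _; case: (odd t).
rewrite /link_size.
by case: (odd t); case: (c %% t)%N lt => [|r] /=; case: (odd _).
Qed.

(** The arc that contains the link [j] is numbered by the count of the elements
    of [U] up to [j], modulo [#|U|]. *)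
Lemma cyclic_link_size n (U : {set 'I_n}) : #|U| != 1%N ->
  exists m : 'I_n -> nat, forall j,
    [/\ odd (m j), (m j < necklace_flow_number #|U|)%N
      & (m (ordS j) == m j) = (ordS j \notin U)].
Proof.
move=> U1; pose t := #|U|; pose c (j : 'I_n) := #|[set i in U | (i <= j)%N]|.
have cS j : (c (ordS j) %% t = (c j + (ordS j \in U)) %% t)%N.
  case: (ltnP j.+1 n) => jn.
    have Sj : ordS j = j.+1 :> nat by rewrite /= modn_small.
    rewrite /c (cardsD1 (ordS j)) inE leqnn andbT addnC.
    congr (((_ + _) %% _)%N); apply: eq_card => i.
    by rewrite !inE Sj -(inj_eq (@ord_inj _)) Sj; lia.
  have nj : j.+1 = n by apply/eqP; rewrite eqn_leq jn ltn_ord.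
  have S0 : ordS j = 0%N :> nat by rewrite /= nj modnn.
  have -> : c j = t.
    apply: eq_card => i; rewrite inE andb_idr // => _.
    by move: (ltn_ord i); lia.
  rewrite modnDl; congr ((_ %% _)%N); rewrite /c.
  case: (boolP (ordS j \in U)) => jU.
    rewrite (_ : [set i in U | _] = [set ordS j]) ?cards1 //.
    apply/setP => i; rewrite !inE -(inj_eq (@ord_inj _)) S0 leqn0.
    apply: andb_idl => /eqP i0.
    by rewrite (_ : i = ordS j) //; apply: ord_inj; rewrite S0.
  apply/eqP; rewrite cards_eq0; apply/eqP/setP => i; rewrite !inE S0 leqn0.
  apply/negP => /andP[iU /eqP i0]; case/negP: jU.
  by rewrite (_ : ordS j = i) //; apply: ord_inj; rewrite S0.
exists (fun j => link_size t (c j %% t)%N) => j; split.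
- by rewrite /link_size; do 2!case: ifP => // _.
- rewrite /necklace_flow_number -/t; case: eqP => [t0|_].
    have : (c j <= t)%N.
      by apply/subset_leq_card/fintype.subsetP => i; rewrite inE => /andP[].
    by rewrite t0 leqn0 => /eqP ->.
  by rewrite /link_size; case: (odd t) => /=; do ?case: ifP.
rewrite cS; case: (boolP (ordS j \in U)) => jU /=; last by rewrite addn0 eqxx.
rewrite addn1; apply/negbTE/link_size_neq.
have t0 : (0 < t)%N by apply/card_gt0P; exists (ordS j).
by move: U1; rewrite -/t; lia.
Qed.

(** * Flow numbers and the spectrum *)

Lemma consistent_nz_flow (R : realType) n (sigma : signature (necklace n)) z :
  consistent sigma z -> #|unbalanced sigma| != 1%N ->
  admits_integer_nz_flow R sigma (necklace_flow_number #|unbalanced sigma|).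
Proof.
move=> zcons U1; have [m mP] := cyclic_link_size U1.
set k := necklace_flow_number _ in mP *.
have k3 : (3 <= k)%N by rewrite /k /necklace_flow_number; do ?case: ifP.
pose y j := sgn int (z j) * (m j)%:Z.
have ybnd j : 1 <= `|y j| <= k%:Z - 1.
  by have [o l _] := mP j; rewrite /y sgn_mulE; case: (z j); lia.
have /boolp.choice[ab abP] j : exists ab : int * int,
    [/\ ab.1 + ab.2 = sgn int (sigma (inl (link j))) * y j,
        y (ordS j) = sgn int (sigma (inl (dbl_ord (ordS j)))) * ab.1
          + sgn int (sigma (inr (ordS j))) * ab.2,
        1 <= `|ab.1| <= k%:Z - 1 & 1 <= `|ab.2| <= k%:Z - 1].
  apply: digon_split; [lia | by rewrite norm_sgn_mul | by [] |].
  have [oj _ mj] := mP j; have [oSj _ _] := mP (ordS j).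
  case: ifPn => bal.
    have jU : ordS j \notin unbalanced sigma by rewrite inE negbK.
    rewrite /y zcons //; move: mj; rewrite jU => /eqP ->.
    rewrite !sgn_mulE.
    by case: (z j); case: (sigma _); case: (sigma _) => /=; lia.
  have jU : ordS j \in unbalanced sigma by rewrite inE.
  move: mj; rewrite jU /= => /eqP mj.
  rewrite /y !sgn_mulE; split; first by do !case: ifP => _; lia.
  have h i : odd (m i) -> exists q : int, (m i)%:Z = 2 * q + 1.
    by move=> o; exists (m i)./2%:Z; lia.
  have [q ->] := h _ oj; have [q' ->] := h _ oSj.
  (* [w - u] is even, being a difference of two odd numbers with signs. *)
  case: (z j); case: (z _); case: (sigma _);
    by [exists (q' - q); lia | exists (q - q'); lia
       | exists (q' + q + 1); lia | exists (- q' - q - 1); lia].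
apply/integer_nz_flowP.
exists (fun e : edge (necklace n) => match e with
  | inl i => if odd i then y (bead i) else (ab (ord_pred (bead i))).1
  | inr j => (ab (ord_pred j)).2 end) => [j | [i|j]].
- rewrite val_link !bead_link !bead_dbl /= !odd_double /=.
  have [Sj _ _ _] := abP j; have [_ yj _ _] := abP (ord_pred j).
  by rewrite ordSK Sj; move: yj; rewrite ord_predK.
- by case: ifP => // _; have [] := abP (ord_pred (bead i)).
- by have [] := abP (ord_pred j).
Qed.

(** The real flow of the admissibility hypothesis supplies the signs of the
    integer flow. *)
Lemma flow_numberE (R : realType) n (sigma : signature (necklace n)) :
  (0 < n)%N -> flow_admissible R sigma ->
  flow_number R sigma = necklace_flow_number #|unbalanced sigma|.
Proof.
move=> n0 [r [_ [tau [f [ori fl nz]]]]].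
have [cons bnd] := nz_flow_conserved ori fl nz.
have x0 e : sgn R (tau (e, false)) * f e != 0.
  by rewrite -normr_gt0; case/andP: (bnd e) => /(lt_le_trans ltr01).
have fn : is_flow_number R sigma (necklace_flow_number #|unbalanced sigma|).
  split; first by rewrite /necklace_flow_number; do ?case: ifP.
    exact: consistent_nz_flow (link_sign_consistent cons x0) (unbalanced_neq1 cons x0).
  by move=> k _; apply: integer_nz_flow_ge.
have [k2 adm min] := fn.
apply/xget_unique => // k [k2' adm' min'].
by apply/eqP; rewrite eqn_leq min' // min.
Qed.

Definition unbalanced_at n (U : {set 'I_n}) : signature (necklace n) :=
  fun e => if e is inr j then j \in U else false.

Lemma integer_flow_spectrum_necklace (R : realType) n : (0 < n)%N ->
  integer_flow_spectrum R (necklace n) =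
  [set necklace_flow_number t | t in [set t | (t <= n)%N && (t != 1%N)]]%classic.
Proof.
move=> n0; apply/seteqP; split=> [_ [sigma adm <-] | _ [t /andP[tn t1] <-]] /=.
  rewrite flow_numberE //; exists #|unbalanced sigma| => //=.
  rewrite -[X in (_ <= X)%N]card_ord max_card /=.
  have [r [_ [tau [f [ori fl nz]]]]] := adm.
  have [cons bnd] := nz_flow_conserved ori fl nz.
  apply: (unbalanced_neq1 cons) => e.
  by rewrite -normr_gt0; case/andP: (bnd e) => /(lt_le_trans ltr01).
pose U := [set i : 'I_n | (i < t)%N]; pose sigma := unbalanced_at U.
have UE : unbalanced sigma = U.
  by apply/setP => j; rewrite inE /sigma /=; case: (j \in U).
have Ut : #|U| = t.
  rewrite -sum1_card (eq_bigl (fun i : 'I_n => (i < t)%N)) => [|i];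
    last by rewrite inE.
  by rewrite (big_ord_narrow tn) sum1_card card_ord.
have adm : flow_admissible R sigma.
  exists (necklace_flow_number t)%:R; split.
    by rewrite ler_nat /necklace_flow_number; do ?case: ifP.
  apply: integer_nz_flow_real; rewrite -Ut -UE.
  by apply: (@consistent_nz_flow _ _ _ (fun=> false)) => //; rewrite UE Ut.
by exists sigma => //; rewrite flow_numberE // UE Ut.
Qed.

Local Open Scope classical_set_scope.

Theorem theorem6p12 (R : realType) (n : nat) (hn : (1 <= n)%N) :
  (n = 1%N -> integer_flow_spectrum R (necklace n) = [set 3%N]) /\
  (n = 2%N -> integer_flow_spectrum R (necklace n) = [set 3%N; 4%N]) /\
  ((3 <= n)%N -> integer_flow_spectrum R (necklace n) = [set 3%N; 4%N; 6%N]).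
Proof.
rewrite integer_flow_spectrum_necklace //.
split=> [->|]; [|split=> [->|n3]]; apply/seteqP; split=> k.
- by case=> -[|[]].
- by move=> ->; exists 0.
- by case=> -[|[|[]]] //= _ <-; [left|right].
- by case=> ->; [exists 0 | exists 2].
- case=> t _ <-; rewrite /necklace_flow_number /=.
  by case: ifP; [left; left | case: ifP; [right | left; right]].
- by case=> [[]|] ->; [exists 0 | exists 2 => //=; lia | exists 3 => //=; lia].
Qed.
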